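(* Let $q\ge 3$ be an integer. For any $\delta\in\left[0,1-\frac1q\right]$ and $\gamma\in[0,(q-1)(1-\delta)]$, the inner bound $$1-(1-\delta+\gamma)H_q\left(\frac{\gamma}{1-\delta+\gamma}\right)-H_q(\delta)+\gamma\log_q(q-1)$$ is stronger, i.e. larger, than the inner bound $$1-(1-\delta+2\gamma)H_q\left(\frac{\gamma}{1-\delta+2\gamma}\right)-H_q(\delta)+\gamma\log_q(q-1);$$ that is, $$1-(1-\delta+\gamma)H_q\left(\frac{\gamma}{1-\delta+\gamma}\right)-H_q(\delta)+\gamma\log_q(q-1)\ >\ 1-(1-\delta+2\gamma)H_q\left(\frac{\gamma}{1-\delta+2\gamma}\right)-H_q(\delta)+\gamma\log_q(q-1).$$
   Context: The $q$-ary entropy function is $H_q(x)=x\log_q(q-1)-x\log_q x-(1-x)\log_q(1-x)$ for $x\in[0,1]$, with $0\log_q 0=0$. Both expressions are lower (inner) bounds on the highest rate achievable by families of $q$-ary codes of block length $n$ that are list-decodable (with polynomial list size) from $\gamma n$ insertions and $\delta n$ deletions. The first is obtained from an analysis of random codes; the second is an earlier bound due to Liu, Tjuawinata and Xing.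
   Formalization: The strict inequality is proved only for γ > 0; at γ = 0 the two inner bounds are the same expression and hence equal, so the strict claim fails there and only ''≥'' is stated. *)

(* Defs.v *)
From Stdlib Require Export Reals.
Open Scope R_scope.

(* The convention 0 log_q 0 = 0 holds because multiplication by 0 gives 0
   ([Rlog q 0] is a total, finite value). *)
Definition qary_entropy (q : nat) (x : R) : R :=
  x * Rlog (INR q) (INR q - 1)
  - x * Rlog (INR q) x
  - (1 - x) * Rlog (INR q) (1 - x).

(* [gamma] is the fraction of insertions, [delta] the fraction of deletions. *)
Definition random_code_inner_bound (q : nat) (delta gamma : R) : R :=
  1 - (1 - delta + gamma) * qary_entropy q (gamma / (1 - delta + gamma))
  - qary_entropy q delta + gamma * Rlog (INR q) (INR q - 1).

(* Liu, Tjuawinata and Xing. *)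
Definition LTX_inner_bound (q : nat) (delta gamma : R) : R :=
  1 - (1 - delta + 2 * gamma) * qary_entropy q (gamma / (1 - delta + 2 * gamma))
  - qary_entropy q delta + gamma * Rlog (INR q) (INR q - 1).

(* Main.v *)
Require Import Defs.
From Stdlib Require Import Reals Lra.
Open Scope R_scope.

(** Writing [a = 1 - delta] and [phi x = x * ln x], one finds
    [ln q * A * H_q (gamma / A) = gamma * ln (q - 1) - phi gamma - phi (A - gamma) + phi A],
    so [ln q] times the difference of the two bounds is
    [phi (a + 2 * gamma) - 2 * phi (a + gamma) + phi a], which is positive by
    strict midpoint convexity of [phi]. *)

(** This is [1 + t < exp t] for [t <> 0], taken at [t = ln m - ln x] and multiplied by [x]. It says
    that the graph of [x * ln x] lies strictly above its tangent at [m]. *)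
Lemma x_ln_x_above_tangent (x m : R) :
  0 < x -> 0 < m -> x <> m -> x - m < x * ln x - x * ln m.
Proof.
  intros hx hm hne.
  assert (hneq : ln m - ln x <> 0).
  { intro h. apply hne, ln_inv; lra. }
  pose proof (exp_ineq1 _ hneq) as h.
  unfold Rminus in h at 2. rewrite exp_plus, exp_Ropp, !exp_ln in h by assumption.
  apply (Rmult_lt_compat_l x) in h; [|assumption].
  replace (x * (m * / x)) with m in h by (field; lra).
  lra.
Qed.

Lemma x_ln_x_midpoint_convex (a g : R) :
  0 < a -> 0 < g ->
  2 * ((a + g) * ln (a + g)) < a * ln a + (a + 2 * g) * ln (a + 2 * g).
Proof.
  intros ha hg.
  (* Both tangents are taken at the midpoint [a + g], so the linear terms [- g] and [g] cancel in
     the sum. *)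
  assert (h1 := x_ln_x_above_tangent a (a + g) ltac:(lra) ltac:(lra) ltac:(lra)).
  assert (h2 := x_ln_x_above_tangent (a + 2 * g) (a + g)
                  ltac:(lra) ltac:(lra) ltac:(lra)).
  lra.
Qed.

Lemma ln_div (x y : R) : 0 < x -> 0 < y -> ln (x / y) = ln x - ln y.
Proof.
  intros hx hy. unfold Rdiv.
  rewrite ln_mult, ln_Rinv; auto using Rinv_0_lt_compat.
Qed.

(** After the logarithms of quotients are split, [g * ln A] and [(A - g) * ln A] combine into
    [A * ln A]. *)
Lemma scaled_qary_entropy (q : nat) (g A : R) :
  0 < ln (INR q) -> 0 < g < A ->
  A * qary_entropy q (g / A) =
  (g * ln (INR q - 1) - g * ln g - (A - g) * ln (A - g) + A * ln A) / ln (INR q).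
Proof.
  intros hq [hg hA]. unfold qary_entropy, Rlog.
  replace (1 - g / A) with ((A - g) / A) by (field; lra).
  rewrite !ln_div by lra.
  field. lra.
Qed.

(** At [gamma = 0] the two bounds coincide, so the strict inequality is claimed only for
    [0 < gamma]. *)
Theorem theorem3p4 (q : nat) (delta gamma : R)
  (hq : (3 <= q)%nat)
  (hdelta : 0 <= delta <= 1 - 1 / INR q)
  (hgamma : 0 <= gamma <= (INR q - 1) * (1 - delta)) :
  random_code_inner_bound q delta gamma >= LTX_inner_bound q delta gamma /\
  (0 < gamma -> random_code_inner_bound q delta gamma > LTX_inner_bound q delta gamma).
Proof.
  assert (hq3 : 3 <= INR q) by (apply le_INR in hq; simpl in hq; lra).
  assert (ha : 0 < 1 - delta).
  { assert (0 < 1 / INR q) by (apply Rdiv_lt_0_compat; lra). lra. }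
  assert (hln : 0 < ln (INR q)) by (rewrite <- ln_1; apply ln_increasing; lra).
  assert (strict : 0 < gamma ->
    random_code_inner_bound q delta gamma > LTX_inner_bound q delta gamma).
  { intro hg. unfold random_code_inner_bound, LTX_inner_bound.
    rewrite !scaled_qary_entropy by lra.
    (* The term [(A - g) * ln (A - g)] of the second bound now equals the term [A * ln A] of the
       first, which produces the doubled middle term of the convexity inequality. *)
    replace (1 - delta + gamma - gamma) with (1 - delta) by ring.
    replace (1 - delta + 2 * gamma - gamma) with (1 - delta + gamma) by ring.
    pose proof (x_ln_x_midpoint_convex (1 - delta) gamma ha hg).
    enough (forall u v, u < v -> u / ln (INR q) < v / ln (INR q)) as mono.
    { match goal with
      | |- 1 - ?u / _ - _ + _ > 1 - ?v / _ - _ + _ =>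
          assert (u / ln (INR q) < v / ln (INR q)) by (apply mono; lra)
      end.
      lra. }
    intros u v huv. apply Rmult_lt_compat_r; [now apply Rinv_0_lt_compat | assumption]. }
  split; [|exact strict].
  destruct (Rle_lt_or_eq_dec 0 gamma (proj1 hgamma)) as [hg | <-].
  - apply Rgt_ge, strict, hg.
  - unfold random_code_inner_bound, LTX_inner_bound.
    rewrite Rmult_0_r. apply Rge_refl.
Qed.
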